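(* Let $\mathcal{H}$ be a real inner product space with $3\le \dim(\mathcal{H})\le \infty$, and let $\tilde{\mathcal{H}}$ be its completion. Let $A_1,A_2,A_3:\mathcal{H}\to\tilde{\mathcal{H}}$ be (not necessarily bounded) linear transformations such that there exist $\mu_1,\mu_2,\mu_3\in\mathbb{R}$ with $\mu_1A_1+\mu_2A_2+\mu_3A_3>0$. Then the set $$F(\mathcal{H})=\{(\langle A_1x,x\rangle,\langle A_2x,x\rangle,\langle A_3x,x\rangle)\in\mathbb{R}^3 : x\in\mathcal{H}\}$$ is a convex cone in $\mathbb{R}^3$.
   Context: For a linear map $T:\mathcal{H}\to\tilde{\mathcal{H}}$ (where $\mathcal{H}$ is regarded as a dense subspace of its completion $\tilde{\mathcal{H}}$, and $\langle\cdot,\cdot\rangle$ also denotes the extended inner product on $\tilde{\mathcal{H}}$), $T>0$ (positive definite) means that $T$ is symmetric, i.e. $\langle Tx,y\rangle=\langle x,Ty\rangle$ for all $x,y\in\mathcal{H}$, and $\langle Tx,x\rangle>0$ for all $x\in\mathcal{H}$, $x\neq 0$. Each individual $A_i$ is not assumed symmetric. The condition $3\le\dim(\mathcal{H})\le\infty$ means that $\mathcal{H}$ has dimension at least $3$, possibly infinite. A cone is a set closed under multiplication by nonnegative scalars. *)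

(* Defs.v *)
From HB Require Import structures.
From mathcomp Require Import all_boot all_order all_algebra.
From mathcomp Require Import all_classical all_reals all_analysis.

Set Implicit Arguments.
Unset Strict Implicit.
Unset Printing Implicit Defensive.

Import Order.TTheory GRing.Theory Num.Theory.
Import numFieldNormedType.Exports.

Local Open Scope classical_set_scope.
Local Open Scope ring_scope.

(* A real inner product on [V] is a term of type [{dot V for idfun}]. *)

(* [dim_ge V n] is dim V >= n; unlike [vectType]'s [\dim], it also makes sense
   when [V] is infinite-dimensional. *)
Definition lin_indep (R : realType) (V : lmodType R) (n : nat)
    (v : 'I_n -> V) : Prop :=
  forall c : 'I_n -> R, \sum_(i < n) c i *: v i = 0 -> forall i, c i = 0.

Definition dim_ge (R : realType) (V : lmodType R) (n : nat) : Prop :=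
  exists v : 'I_n -> V, lin_indep v.

(* The completion of [H] is only determined up to isometric isomorphism: it is
   any complete space [Ht], normed by its inner product [dott], with a linear
   isometric embedding [iota] of [H] onto a dense subspace. *)
Definition is_completion (R : realType) (H : lmodType R)
    (Ht : completeNormedModType R)
    (dot : {dot H for idfun}) (dott : {dot Ht for idfun})
    (iota : {linear H -> Ht}) : Prop :=
  [/\ forall u : Ht, `|u| = Num.sqrt (dott u u),
      isometry dott dot iota
    & dense (range iota)].

Section Operators.
Context (R : realType) (H : lmodType R) (Ht : completeNormedModType R).
Context (dott : {dot Ht for idfun}) (iota : {linear H -> Ht}).

Definition symmetric_op (T : H -> Ht) : Prop :=
  forall x y : H, dott (T x) (iota y) = dott (iota x) (T y).

Definition posdef_op (T : H -> Ht) : Prop :=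
  symmetric_op T /\ (forall x : H, x != 0 -> 0 < dott (T x) (iota x)).

Definition joint_range (n : nat) (A : 'I_n -> {linear H -> Ht}) :
    set 'rV[R]_n :=
  [set \row_(i < n) dott (A i x) (iota x) | x in [set: H]].

End Operators.

Definition cone (R : realType) (V : lmodType R) (C : set V) : Prop :=
  forall (a : R) (x : V), 0 <= a -> C x -> C (a *: x).

Definition convex_cone (R : realType) (V : lmodType R) (C : set V) : Prop :=
  cone C /\ convex_set (C : set (convex_lmodType V)).

(* Main.v *)
(* Only the positivity of P = mu_1 f_1 + mu_2 f_2 + mu_3 f_3, where
   f_i x = <A_i x, x>, matters. Let p be a convex combination of F x and F y,
   F = (f_1, f_2, f_3), and put G z = P z p - (mu . p) F z: a nonzero zero z of G
   yields p after rescaling. Since mu . G = 0, the values of G lie in a plane, and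
   G x, G y are multiples of opposite signs of d = P x F y - P y F x, so G = 0
   amounts to q = r = 0 with q = (mu x d) . G vanishing at x and y, and r = d . G
   changing sign between them. In the span of x, y and a third independent vector,
   the conic q = 0 joins x to y or -y in the projective plane, and the intermediate
   value theorem gives a zero of r on it. *)
Require Import Defs.
From HB Require Import structures.
From mathcomp Require Import all_boot all_order all_algebra.
From mathcomp Require Import all_classical all_reals all_analysis.
From mathcomp Require Import ring lra.

Set Implicit Arguments.
Unset Strict Implicit.
Unset Printing Implicit Defensive.

Import Order.TTheory GRing.Theory Num.Theory.
Import numFieldNormedType.Exports.

Local Open Scope classical_set_scope.
Local Open Scope ring_scope.

(** * Orthogonality in three coordinates *)

Lemma sum3_sqr_eq0 (R : realDomainType) (a b c : R) :
  a ^+ 2 + b ^+ 2 + c ^+ 2 = 0 -> [/\ a = 0, b = 0 & c = 0].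
Proof.
move=> /eqP; rewrite !paddr_eq0 ?addr_ge0 ?sqr_ge0// !sqrf_eq0.
by move=> /andP[/andP[/eqP-> /eqP->] /eqP->].
Qed.

(* The cross product of [m] and [d] completes them to a basis of R^3. *)
Lemma orthogonal_frame_eq0 (R : realFieldType) (m1 m2 m3 d1 d2 d3 g1 g2 g3 : R) :
  m1 ^+ 2 + m2 ^+ 2 + m3 ^+ 2 != 0 -> d1 ^+ 2 + d2 ^+ 2 + d3 ^+ 2 != 0 ->
  m1 * d1 + m2 * d2 + m3 * d3 = 0 ->
  m1 * g1 + m2 * g2 + m3 * g3 = 0 -> d1 * g1 + d2 * g2 + d3 * g3 = 0 ->
  (m2 * d3 - m3 * d2) * g1 + (m3 * d1 - m1 * d3) * g2 +
    (m1 * d2 - m2 * d1) * g3 = 0 ->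
  [/\ g1 = 0, g2 = 0 & g3 = 0].
Proof.
set M := (X in X != 0 -> _); set D := (X in _ -> X != 0 -> _).
set n1 := m2 * d3 - m3 * d2; set n2 := m3 * d1 - m1 * d3.
set n3 := m1 * d2 - m2 * d1 => M0 D0 md mg dg ng.
(* Lagrange's identity; it makes the cross product n of m and d nonzero. *)
have MD : n1 ^+ 2 + n2 ^+ 2 + n3 ^+ 2 = M * D.
  have -> : n1 ^+ 2 + n2 ^+ 2 + n3 ^+ 2 =
      M * D - (m1 * d1 + m2 * d2 + m3 * d3) ^+ 2.
    by rewrite /n1 /n2 /n3 /M /D; ring.
  by rewrite md expr0n subr0.
have MD0 : M * D != 0 by rewrite mulf_neq0.
(* Cramer's rule: m, d, n have determinant |n|^2, and their dual basis multiplied by it is d x n, n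
   x m, n. *)
have e1 : (n1 ^+ 2 + n2 ^+ 2 + n3 ^+ 2) * g1 =
    (n1 * g1 + n2 * g2 + n3 * g3) * n1
    + (m1 * g1 + m2 * g2 + m3 * g3) * (d2 * n3 - d3 * n2)
    + (d1 * g1 + d2 * g2 + d3 * g3) * (n2 * m3 - n3 * m2).
  by rewrite /n1 /n2 /n3; ring.
have e2 : (n1 ^+ 2 + n2 ^+ 2 + n3 ^+ 2) * g2 =
    (n1 * g1 + n2 * g2 + n3 * g3) * n2
    + (m1 * g1 + m2 * g2 + m3 * g3) * (d3 * n1 - d1 * n3)
    + (d1 * g1 + d2 * g2 + d3 * g3) * (n3 * m1 - n1 * m3).
  by rewrite /n1 /n2 /n3; ring.
have e3 : (n1 ^+ 2 + n2 ^+ 2 + n3 ^+ 2) * g3 =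
    (n1 * g1 + n2 * g2 + n3 * g3) * n3
    + (m1 * g1 + m2 * g2 + m3 * g3) * (d1 * n2 - d2 * n1)
    + (d1 * g1 + d2 * g2 + d3 * g3) * (n1 * m2 - n2 * m1).
  by rewrite /n1 /n2 /n3; ring.
rewrite MD ng mg dg !mul0r !addr0 in e1 e2 e3.
by split; apply: (mulfI MD0); rewrite mulr0.
Qed.

(** * Quadratic forms and their common zeros *)

Definition polar (R : pzRingType) (V : lmodType R) (f : V -> R) (u v : V) : R :=
  f (u + v) - f u - f v.

(* For scalars in a field this is equivalent to [f u = B u u] for a bilinear
   [B]; being linear in [f], it is visibly stable under combinations. *)
Definition quadratic_form (R : pzRingType) (V : lmodType R) (f : V -> R) : Prop :=
  forall (a b c : R) (u v w : V),
    f (a *: u + b *: v + c *: w) =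
      a ^+ 2 * f u + b ^+ 2 * f v + c ^+ 2 * f w +
      a * b * polar f u v + a * c * polar f u w + b * c * polar f v w.

Definition lin_indep3 (R : pzRingType) (V : lmodType R) (x y w : V) : Prop :=
  forall a b c : R, a *: x + b *: y + c *: w = 0 -> [/\ a = 0, b = 0 & c = 0].

Section QuadraticForms.
Context (R : rcfType) (V : lmodType R).
Implicit Types (f g h q r : V -> R) (u v w x y z : V).

Lemma polarC f u v : polar f u v = polar f v u.
Proof. by rewrite /polar [u + v]addrC addrAC. Qed.

(* Unlike [hornerE], this does not also simplify by the generic monoid laws,
   which leave [ring] with products it does not recognize. *)
Let heval := (@hornerD R, @hornerN R, @horner_exp R, @hornerM R, @hornerX R,
  @hornerC R).

Lemma quadratic_formZ f a u : quadratic_form f -> f (a *: u) = a ^+ 2 * f u.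
Proof. by move=> /(_ a 0 0 u 0 0); rewrite !scaler0 !addr0 => ->; ring. Qed.

Lemma quadratic_form_comb f g h a b c :
  quadratic_form f -> quadratic_form g -> quadratic_form h ->
  quadratic_form (fun z => a * f z + b * g z + c * h z).
Proof.
by move=> Qf Qg Qh a' b' c' u v w; rewrite Qf Qg Qh /polar; ring.
Qed.

(** Along a curve with polynomial coefficients on three fixed vectors, [f] is a polynomial in the
    parameter, so the intermediate value theorem for polynomials applies. *)
Lemma quadratic_form_ivt f (a b c : {poly R}) x y w (t0 t1 : R) :
  quadratic_form f -> t0 <= t1 ->
  f (a.[t1] *: x + b.[t1] *: y + c.[t1] *: w) <= 0 ->
  0 <= f (a.[t0] *: x + b.[t0] *: y + c.[t0] *: w) ->
  exists t : R, f (a.[t] *: x + b.[t] *: y + c.[t] *: w) = 0.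
Proof.
move=> Qf t01 f1 f0.
pose p := a ^+ 2 * (f x)%:P + b ^+ 2 * (f y)%:P + c ^+ 2 * (f w)%:P +
  a * b * (polar f x y)%:P + a * c * (polar f x w)%:P + b * c * (polar f y w)%:P.
have pE t : p.[t] = f (a.[t] *: x + b.[t] *: y + c.[t] *: w).
  by rewrite Qf /p !heval.
have [|t _ /rootP] := @poly_ivt _ (- p) _ _ t01.
  by rewrite !hornerN !pE oppr_le0 oppr_ge0 f0 f1.
by move=> /eqP; rewrite hornerN oppr_eq0 pE => /eqP; exists t.
Qed.

Lemma lin_indep3_neq0 x y w a b c : lin_indep3 x y w ->
  ~ [/\ a = 0, b = 0 & c = 0] -> a *: x + b *: y + c *: w != 0.
Proof. by move=> xyw abc; apply/eqP => /xyw. Qed.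

(** Here [q] vanishes on the whole span of [x] and [y], and [r] changes sign along the segment
    joining them, which avoids 0 by independence. *)
Lemma quadratic_form_segment q r x y w : lin_indep3 x y w ->
  quadratic_form q -> quadratic_form r -> q x = 0 -> q y = 0 ->
  polar q x y = 0 -> 0 <= r x -> r y <= 0 ->
  exists z, [/\ z != 0, q z = 0 & r z = 0].
Proof.
move=> xyw Qq Qr qx qy qxy rx ry.
have [||t rt] := @quadratic_form_ivt r (1%:P - 'X) 'X 0%:P x y w 0 1 Qr ler01.
- by rewrite !heval subrr !scale0r add0r addr0 scale1r.
- by rewrite !heval subr0 !scale0r !addr0 scale1r.
exists ((1%:P - 'X).[t] *: x + 'X.[t] *: y + 0%:P.[t] *: w).
split=> //; last by rewrite Qq !heval qx qy qxy; ring.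
apply: lin_indep3_neq0 xyw _ => -[]; rewrite !heval => t1 t0 _; lra.
Qed.

(* A conic through two points [x], [y] of the plane, with [q]-orthogonal third
   vector [w], is parametrized by [(1-t)^2 x - (q w / polar q x y) t^2 y
   + t (1-t) w]; along it [r] changes sign. When [q w = 0] it degenerates into
   the lines joining [w] to [x] and [y]. *)
Lemma quadratic_form_conic q r x y w : lin_indep3 x y w ->
  quadratic_form q -> quadratic_form r -> q x = 0 -> q y = 0 ->
  polar q x w = 0 -> polar q y w = 0 -> polar q x y != 0 ->
  0 <= r x -> r y <= 0 ->
  exists z, [/\ z != 0, q z = 0 & r z = 0].
Proof.
move=> xyw Qq Qr qx qy qxw qyw qxy rx ry.
have [qw|qw] := eqVneq (q w) 0.
  have [rw|rw] := lerP (r w) 0.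
    apply: (@quadratic_form_segment q r x w y) => //.
    by move=> a b c; rewrite addrAC => /xyw[-> -> ->].
  apply: (@quadratic_form_segment q r w y x) => //; last exact: ltW.
    by move=> a b c; rewrite addrC addrA addrAC => /xyw[-> -> ->].
  by rewrite polarC.
pose k := - (q w / polar q x y).
have k0 : k != 0 by rewrite oppr_eq0 mulf_neq0// invr_eq0.
have [||t rt] := @quadratic_form_ivt r ((1%:P - 'X) ^+ 2) (k%:P * 'X ^+ 2)
    ('X * (1%:P - 'X)) x y w 0 1 Qr ler01.
- rewrite !heval subrr ?expr2 !(mulr0, mulr1) !(scale0r, addr0, add0r).
  by rewrite (quadratic_formZ _ _ Qr) mulr_ge0_le0// sqr_ge0.
- by rewrite !heval subr0 ?expr2 !(mulr0, mul0r, mulr1) !(scale0r, addr0) scale1r.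
exists (((1%:P - 'X) ^+ 2).[t] *: x + (k%:P * 'X ^+ 2).[t] *: y +
  ('X * (1%:P - 'X)).[t] *: w).
split=> //; last by rewrite Qq !heval qx qy qxw qyw /k; field.
(* The coefficient of [x] vanishes only at t = 1, where that of [y] is [k], which is nonzero. *)
apply: lin_indep3_neq0 xyw _ => -[]; rewrite !heval => /eqP.
rewrite sqrf_eq0 subr_eq0 => /eqP <-.
by rewrite expr1n mulr1 => /eqP; rewrite (negPf k0).
Qed.

(** If [polar q x y] is nonzero, [q] is nondegenerate on the span of [x] and [y], so subtracting a
    projection makes [w] orthogonal to both for [q], as [quadratic_form_conic] requires. *)
Lemma quadratic_form_common_zero q r x y w : lin_indep3 x y w ->
  quadratic_form q -> quadratic_form r -> q x = 0 -> q y = 0 ->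
  0 <= r x -> r y <= 0 ->
  exists z, [/\ z != 0, q z = 0 & r z = 0].
Proof.
move=> xyw Qq Qr qx qy rx ry.
have [qxy|qxy] := eqVneq (polar q x y) 0.
  exact: quadratic_form_segment xyw _ _ _ _ _ _ _.
(* Since [q] vanishes at [x] and [y], orthogonality of [w'] to [y] determines [a], and orthogonality
   to [x] determines [b]. *)
pose a := - (polar q y w / polar q x y); pose b := - (polar q x w / polar q x y).
pose w' := a *: x + b *: y + 1 *: w.
have qw' : q w' = q w + a * b * polar q x y + a * polar q x w + b * polar q y w.
  by rewrite Qq qx qy; ring.
apply: (@quadratic_form_conic q r x y w') => //.
- move=> c d e; rewrite /w' => cde.
  have /xyw[] : (c + e * a) *: x + (d + e * b) *: y + e *: w = 0.
    by rewrite -[RHS]cde scale1r !scalerDr !scalerA !scalerDl !addrA;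
       congr (_ + _ + _); rewrite addrAC.
  by move=> + + e0; rewrite e0 !mul0r !addr0.
- rewrite /polar qw'; have -> : x + w' = (1 + a) *: x + b *: y + 1 *: w.
    by rewrite /w' scalerDl !scale1r !addrA.
  by rewrite Qq qx qy /a /b; field.
- rewrite /polar qw'; have -> : y + w' = a *: x + (1 + b) *: y + 1 *: w.
    by rewrite /w' scalerDl !scale1r !addrA [y + _]addrC.
  by rewrite Qq qx qy /a /b; field.
Qed.

End QuadraticForms.

(** * Convexity of the joint range of three forms *)

Lemma dim_ge3_extend (R : realType) (V : lmodType R) (x y : V) :
  dim_ge V 3 -> (forall a b : R, a *: x + b *: y = 0 -> a = 0 /\ b = 0) ->
  exists w, lin_indep3 x y w.
Proof.
move=> [v vfree] xyfree; apply: contrapT => noext.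
(* Any [v i] outside the span of [x] and [y] would extend them. *)
have vspan i : exists ab : R * R, v i = ab.1 *: x + ab.2 *: y.
  apply: contrapT => vi; apply: noext; exists (v i) => a b c abc.
  have [c0|c0] := eqVneq c 0.
    by move: abc; rewrite c0 scale0r addr0 => /xyfree[-> ->].
  case: vi; exists (- (c^-1 * a), - (c^-1 * b)) => /=.
  apply: (scalerI c0); rewrite scalerDr !scalerA !mulrN !mulrA mulfV// !mul1r.
  by rewrite !scaleNr -opprD; apply/eqP; rewrite -addr_eq0 addrC abc.
have [ab vE] := choice vspan.
pose M := \matrix_(i < 3, j < 2) (if j == 0 then (ab i).1 else (ab i).2).
(* The three coordinate rows have rank at most 2; a relation [u] between them is one between the
   [v i]. *)
have /rowV0Pn[u /sub_kermxP uM /eqP[]] : kermx M != 0.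
  by rewrite kermx_eq0 /row_free neq_ltn ltnS rank_leq_col.
have uM0 j : \sum_i u 0 i * M i j = 0.
  by move/matrixP: uM => /(_ 0 j); rewrite !mxE.
apply/rowP => i; rewrite mxE; apply: (vfree (u 0)).
rewrite (eq_bigr (fun k => (u 0 k * (ab k).1) *: x + (u 0 k * (ab k).2) *: y));
  last by move=> k _; rewrite vE scalerDr !scalerA.
rewrite big_split -!scaler_suml /=.
have -> : \sum_i u 0 i * (ab i).1 = 0.
  by apply: etrans (uM0 0); apply: eq_bigr => k _; rewrite mxE.
have -> : \sum_i u 0 i * (ab i).2 = 0.
  by apply: etrans (uM0 1); apply: eq_bigr => k _; rewrite mxE.
by rewrite !scale0r addr0.
Qed.

Lemma quadratic_forms_range_convex (R : realType) (V : lmodType R)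
    (f g h : V -> R) (m1 m2 m3 : R) :
  dim_ge V 3 -> quadratic_form f -> quadratic_form g -> quadratic_form h ->
  (forall z, z != 0 -> 0 < m1 * f z + m2 * g z + m3 * h z) ->
  forall (s : R) (x y : V), 0 < s < 1 ->
  exists z, [/\ f z = s * f x + (1 - s) * f y, g z = s * g x + (1 - s) * g y
    & h z = s * h x + (1 - s) * h y].
Proof.
move=> dimV Qf Qg Qh; set P := fun z => m1 * f z + m2 * g z + m3 * h z.
move=> P_gt0 s x y /andP[s0 s1].
have s1' : 0 < 1 - s by rewrite subr_gt0.
have QZ (k : V -> R) (a : R) (u : V) : quadratic_form k -> k (a *: u) = a ^+ 2 * k u.
  exact: quadratic_formZ.
have Q0 (k : V -> R) : quadratic_form k -> k 0 = 0.
  by move=> Qk; rewrite -(scale0r 0) QZ// expr0n mul0r.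
(* If an endpoint is 0, then p is a positive multiple of the value at the other, reached by
   scaling. *)
have [->|x0] := eqVneq x 0.
  exists (Num.sqrt (1 - s) *: y).
  by rewrite !QZ// !Q0// sqr_sqrtr ?ltW// !mulr0 !add0r.
have [->|y0] := eqVneq y 0.
  exists (Num.sqrt s *: x).
  by rewrite !QZ// !Q0// sqr_sqrtr ?ltW// !mulr0 !addr0.
have Px := P_gt0 _ x0; have Py := P_gt0 _ y0; rewrite -!/(P _) in Px Py.
pose d1 := P x * f y - P y * f x; pose d2 := P x * g y - P y * g x.
pose d3 := P x * h y - P y * h x.
(* If d = 0, then F y = (P y / P x) F x, so p is a positive multiple of F x. *)
have [D0|D0] := eqVneq (d1 ^+ 2 + d2 ^+ 2 + d3 ^+ 2) 0.
  have [/eqP e1 /eqP e2 /eqP e3] := sum3_sqr_eq0 D0.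
  rewrite !subr_eq0 in e1 e2 e3; move: e1 e2 e3 => /eqP e1 /eqP e2 /eqP e3.
  have Px0 : P x != 0 by rewrite gt_eqF.
  exists (Num.sqrt (s + (1 - s) * (P y / P x)) *: x).
  rewrite !QZ// sqr_sqrtr; last first.
    by rewrite addr_ge0 ?mulr_ge0 ?divr_ge0 ?invr_ge0 ?ltW.
  by split; apply: (mulfI Px0); rewrite mulrDr (mulrCA (P x) (1 - s)) ?e1 ?e2 ?e3;
    field.
(* If [x] were c y, then F x = c^2 F y, which forces d = 0. *)
have xyfree (a b : R) : a *: x + b *: y = 0 -> a = 0 /\ b = 0.
  move=> ab; have [a0|a0] := eqVneq a 0.
    split=> //; move: ab => /eqP; rewrite a0 scale0r add0r scaler_eq0 (negPf y0).
    by rewrite orbF => /eqP.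
  have xE : x = - (a^-1 * b) *: y.
    apply: (scalerI a0); rewrite scalerA mulrN mulrA mulfV// mul1r scaleNr.
    by apply/eqP; rewrite -addr_eq0 ab.
  by case/eqP: D0; rewrite /d1 /d2 /d3 /P xE !QZ//; ring.
have [w xyw] := dim_ge3_extend dimV xyfree.
pose p1 := s * f x + (1 - s) * f y; pose p2 := s * g x + (1 - s) * g y.
pose p3 := s * h x + (1 - s) * h y.
pose m := m1 * p1 + m2 * p2 + m3 * p3.
have m_gt0 : 0 < m.
  have -> : m = s * P x + (1 - s) * P y by rewrite /m /p1 /p2 /p3 /P; ring.
  by rewrite addr_gt0// mulr_gt0.
pose G1 z := P z * p1 - m * f z; pose G2 z := P z * p2 - m * g z.
pose G3 z := P z * p3 - m * h z.
(* [P] is itself a combination of [f], [g], [h], hence so is each combination of the components of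
   G. *)
have QG (a b c : R) : quadratic_form (fun z => a * G1 z + b * G2 z + c * G3 z).
  pose e := a * p1 + b * p2 + c * p3.
  have -> : (fun z => a * G1 z + b * G2 z + c * G3 z) =
    (fun z => (e * m1 - m * a) * f z + (e * m2 - m * b) * g z
              + (e * m3 - m * c) * h z).
    by apply/funext => z; rewrite /G1 /G2 /G3 /e /P; ring.
  exact: quadratic_form_comb.
have md : m1 * d1 + m2 * d2 + m3 * d3 = 0 by rewrite /d1 /d2 /d3 /P; ring.
(* The terms s P x F x cancel in G x, and (1 - s) P y F y in G y, leaving multiples of d. *)
have [G1x G2x G3x] :
    [/\ G1 x = (1 - s) * d1, G2 x = (1 - s) * d2 & G3 x = (1 - s) * d3].
  by split; rewrite /G1 /G2 /G3 /m /d1 /d2 /d3 /p1 /p2 /p3 /P; ring.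
have [G1y G2y G3y] : [/\ G1 y = - s * d1, G2 y = - s * d2 & G3 y = - s * d3].
  by split; rewrite /G1 /G2 /G3 /m /d1 /d2 /d3 /p1 /p2 /p3 /P; ring.
have D_ge0 : 0 <= d1 ^+ 2 + d2 ^+ 2 + d3 ^+ 2 by rewrite !addr_ge0 ?sqr_ge0.
have [||||z [z0 nG dG]] := quadratic_form_common_zero xyw
  (QG (m2 * d3 - m3 * d2) (m3 * d1 - m1 * d3) (m1 * d2 - m2 * d1)) (QG d1 d2 d3).
- by rewrite G1x G2x G3x; ring.
- by rewrite G1y G2y G3y; ring.
- rewrite G1x G2x G3x.
  have -> : d1 * ((1 - s) * d1) + d2 * ((1 - s) * d2) + d3 * ((1 - s) * d3) =
    (1 - s) * (d1 ^+ 2 + d2 ^+ 2 + d3 ^+ 2) by ring.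
  by rewrite mulr_ge0// ltW.
- rewrite G1y G2y G3y.
  have -> : d1 * (- s * d1) + d2 * (- s * d2) + d3 * (- s * d3) =
    - (s * (d1 ^+ 2 + d2 ^+ 2 + d3 ^+ 2)) by ring.
  by rewrite oppr_le0 mulr_ge0// ltW.
have M0 : m1 ^+ 2 + m2 ^+ 2 + m3 ^+ 2 != 0.
  apply/eqP => /sum3_sqr_eq0[e1 e2 e3]; move: m_gt0.
  by rewrite /m e1 e2 e3 !mul0r !addr0 ltxx.
have mG : m1 * G1 z + m2 * G2 z + m3 * G3 z = 0.
  by rewrite /G1 /G2 /G3 /m /P; ring.
have [/eqP g1 /eqP g2 /eqP g3] := orthogonal_frame_eq0 M0 D0 md mG dG nG.
rewrite !subr_eq0 in g1 g2 g3; move: g1 g2 g3 => /eqP g1 /eqP g2 /eqP g3.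
have Pz := P_gt0 _ z0; rewrite -/(P _) in Pz.
have Pz0 : P z != 0 by rewrite gt_eqF.
(* G z = 0 reads P z p = m F z, which gives the scaling factor. *)
exists (Num.sqrt (m / P z) *: z); rewrite !QZ// sqr_sqrtr ?divr_ge0 ?ltW//.
rewrite -/p1 -/p2 -/p3.
by split; apply: (mulfI Pz0); rewrite ?g1 ?g2 ?g3; field.
Qed.

(** * From operators to quadratic forms *)

Lemma quadratic_form_dot (R : realType) (H : lmodType R) (K : lmodType R)
    (dotK : {dot K for idfun}) (T i : {linear H -> K}) :
  quadratic_form (fun x => dotK (T x) (i x)).
Proof.
have dotDl x y z : dotK (x + y) z = dotK x z + dotK y z by exact: linearDl.
have dotDr x y z : dotK x (y + z) = dotK x y + dotK x z by exact: linearDr.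
have dotZl a x y : dotK (a *: x) y = a * dotK x y by exact: linearZl_LR.
have dotZr a x y : dotK x (a *: y) = a * dotK x y by exact: linearZr_LR.
move=> a b c u v w; rewrite /polar !(linearD T) !(linearD i).
rewrite !(linearZ_LR T) !(linearZ_LR i) /=.
by rewrite !(dotDl, dotDr, dotZl, dotZr); ring.
Qed.

Theorem theorem2p10 (R : realType) (H : lmodType R) (dot : {dot H for idfun})
    (Ht : completeNormedModType R) (dott : {dot Ht for idfun})
    (iota : {linear H -> Ht})
    (completionH : is_completion dot dott iota)
    (dimH : dim_ge H 3)
    (A : 'I_3 -> {linear H -> Ht})
    (posA : exists mu : 'I_3 -> R,
       posdef_op dott iota (fun x : H => \sum_(i < 3) mu i *: A i x)) :
  convex_cone (joint_range dott iota A).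
Proof.
pose F i x := dott (A i x) (iota x).
have QF i : quadratic_form (F i) by exact: quadratic_form_dot.
split=> [a _ a0 [x _ <-]|].
  exists (Num.sqrt a *: x) => //; apply/rowP => i; rewrite !mxE.
  by rewrite -!/(F _ _) (quadratic_formZ _ _ (QF i)) sqr_sqrtr.
have [mu [_ mu_gt0]] := posA.
(* [convex_setW] leaves only weights strictly between 0 and 1. *)
apply/convex_setW => _ _ /set_mem[x _ <-] /set_mem[y _ <-] s s0 s1; apply/mem_set.
pose i1 : 'I_3 := lift ord0 ord0; pose i2 : 'I_3 := lift ord0 (lift ord0 ord0).
have [||z [zf zg zh]] := @quadratic_forms_range_convex R H (F ord0) (F i1) (F i2)
  (mu ord0) (mu i1) (mu i2) dimH (QF _) (QF _) (QF _) _ s%:num x y.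
- move=> z /mu_gt0; rewrite !big_ord_recl big_ord0 addr0 !linearDl.
  by rewrite !linearZl_LR addrA.
- by rewrite s0 s1.
exists z => //; apply/rowP => i; rewrite !mxE.
have [->|->|->] : [\/ i = ord0, i = i1 | i = i2].
  by case: i => -[|[|[|//]]] lt_i; [apply: Or31|apply: Or32|apply: Or33]; apply: val_inj.
- exact: zf.
- exact: zg.
- exact: zh.
Qed.
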